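(* For each integer $r$ and each non-negative integer $n$, \[ \sum_{k = 0}^n \binom {2k}{k} \binom {2(n - k)}{n-k} F_{2k+r} = \sum_{k = 0}^n \binom {n}{k}^2 F_{6k-2n+r}, \qquad \sum_{k = 0}^n \binom {2k}{k} \binom {2(n - k)}{n-k} L_{2k+r} = \sum_{k = 0}^n \binom {n}{k}^2 L_{6k-2n+r}. \]
   Context: $F_j$ and $L_j$ denote the Fibonacci and Lucas numbers: $F_0=0,F_1=1$, $L_0=2,L_1=1$, both satisfying $X_j=X_{j-1}+X_{j-2}$, extended to all integer indices via the recurrence (so $F_{-j}=(-1)^{j+1}F_j$, $L_{-j}=(-1)^jL_j$). *)

(* Defs.v *)
From mathcomp Require Import all_boot all_order all_algebra.
From mathcomp Require Import zify ring.
Set Implicit Arguments.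
Unset Strict Implicit.
Unset Printing Implicit Defensive.

Import GRing.Theory.
Local Open Scope ring_scope.

(* A pair (X_j, X_{j+1}) determines the whole two-sided sequence satisfying
   X_j = X_{j-1} + X_{j-2}: shift it right, or left with
   X_{j-1} = X_{j+1} - X_j. *)
Definition shift_right (p : int * int) : int * int := (p.2, p.1 + p.2).
Definition shift_left (p : int * int) : int * int := (p.2 - p.1, p.1).

Definition two_sided (a b j : int) : int :=
  match j with
  | Posz m => (iter m shift_right (a, b)).1
  | Negz m => (iter m.+1 shift_left (a, b)).1
  end.

Definition fibz : int -> int := two_sided 0 1.
Definition lucz : int -> int := two_sided 2 1.

Lemma two_sided0 a b : two_sided a b 0 = a.
Proof. by []. Qed.

Lemma two_sided1 a b : two_sided a b 1 = b.
Proof. by []. Qed.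

Lemma two_sided_rec a b j :
  two_sided a b j = two_sided a b (j - 1) + two_sided a b (j - 2).
Proof.
case: j => [[|[|m]]|m].
- by rewrite /two_sided /=; ring.
- by rewrite /two_sided /=; ring.
- have -> : m.+2%:Z - 1 = m.+1 by lia.
  have -> : m.+2%:Z - 2 = m by lia.
  by rewrite /two_sided /=; ring.
- have -> : Negz m - 1 = Negz m.+1 by lia.
  have -> : Negz m - 2 = Negz m.+2 by lia.
  by rewrite /two_sided /=; ring.
Qed.

Lemma fibzN (m : nat) : fibz (- m%:Z) = (-1) ^+ m.+1 * fibz m.
Proof.
suff [] : fibz (- m%:Z) = (-1) ^+ m.+1 * fibz m
  /\ fibz (- m.+1%:Z) = (-1) ^+ m.+2 * fibz m.+1 by [].
elim: m => [//|m [IH1 IH2]]; split=> //.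
have := two_sided_rec 0 1 (- m%:Z); have := two_sided_rec 0 1 m.+2.
rewrite -/fibz.
have -> : m.+2%:Z - 1 = m.+1 by lia.
have -> : m.+2%:Z - 2 = m by lia.
have -> : - m%:Z - 1 = - m.+1%:Z by lia.
have -> : - m%:Z - 2 = - m.+2%:Z by lia.
rewrite IH1 IH2 => -> e.
have -> : fibz (- m.+2%:Z)
  = (-1) ^+ m.+1 * fibz m - (-1) ^+ m.+2 * fibz m.+1 by rewrite e; ring.
by rewrite !exprS; ring.
Qed.

Lemma luczN (m : nat) : lucz (- m%:Z) = (-1) ^+ m * lucz m.
Proof.
suff [] : lucz (- m%:Z) = (-1) ^+ m * lucz m
  /\ lucz (- m.+1%:Z) = (-1) ^+ m.+1 * lucz m.+1 by [].
elim: m => [//|m [IH1 IH2]]; split=> //.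
have := two_sided_rec 2 1 (- m%:Z); have := two_sided_rec 2 1 m.+2.
rewrite -/lucz.
have -> : m.+2%:Z - 1 = m.+1 by lia.
have -> : m.+2%:Z - 2 = m by lia.
have -> : - m%:Z - 1 = - m.+1%:Z by lia.
have -> : - m%:Z - 2 = - m.+2%:Z by lia.
rewrite IH1 IH2 => -> e.
have -> : lucz (- m.+2%:Z)
  = (-1) ^+ m * lucz m - (-1) ^+ m.+1 * lucz m.+1 by rewrite e; ring.
by rewrite !exprS; ring.
Qed.

(* Main.v *)
Require Import Defs.
From mathcomp Require Import all_boot all_order all_algebra.
From mathcomp Require Import zify ring.
Import GRing.Theory.
Local Open Scope ring_scope.

(** With [a = 1 - z], [b = 1 + z] one has
    [(b + a u) (a + b u) = (1 + u)^2 - z^2 (1 - u)^2]; comparing the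
    coefficients of [u^n] in the [n]-th powers gives the polynomial identity
    [\sum_k C(2k,k) C(2(n-k),n-k) z^(2k)
       = \sum_k C(n,k)^2 (1 - z)^(2k) (1 + z)^(2(n-k))],
    because the middle coefficient of [(1 + u)^(2m) (1 - u)^(2k)] is, up to
    sign, the super Catalan number [(2k)! (2m)! / (k! m! (m+k)!)].  Reading
    [z^i] as [X_(i+r)] for a Fibonacci-like sequence [X], multiplication by
    [1 + z] shifts the index by [2], and multiplication by [1 - z] shifts it by
    [-1] and changes the sign. *)

Lemma coef_linear_exp (R : comNzRingType) (c d : R) (n i : nat) :
  ((c%:P + d%:P * 'X) ^+ n)`_i = c ^+ (n - i) * d ^+ i * 'C(n, i)%:R.
Proof.
rewrite exprDn coef_sum.
under eq_bigr => j _ do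
  rewrite exprMn -!polyC_exp mulrA -polyCM coefMn coefCM coefXn.
have [lt_in|lt_ni] := ltnP i n.+1.
  rewrite (bigD1 (Ordinal lt_in)) //= eqxx mulr1 mulr_natr big1 ?addr0 // => j ne_ji.
  have /negPf-> : i != j by apply: contra ne_ji => /eqP e; apply/eqP/val_inj.
  by rewrite mulr0 mul0rn.
rewrite bin_small // mulr0 big1 // => j _.
by rewrite gtn_eqF ?mulr0 ?mul0rn // (leq_trans (ltn_ord j)).
Qed.

Definition middle_coef (m k : nat) : int :=
  ((1 + 'X) ^+ (2 * m) * (1 - 'X) ^+ (2 * k) : {poly int})`_(m + k).

Lemma middle_coef0 (m : nat) : middle_coef m 0 = 'C(2 * m, m)%:Z.
Proof.
rewrite /middle_coef muln0 expr0 mulr1 addn0.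
have -> : 1 + 'X = 1%:P + 1%:P * 'X :> {poly int} by rewrite mul1r.
by rewrite coef_linear_exp !expr1n !mul1r natz.
Qed.

(* [(1 - u)^2 = (1 + u)^2 - 4 u]. *)
Lemma middle_coefS (m k : nat) :
  middle_coef m k.+1 = middle_coef m.+1 k - 4 * middle_coef m k.
Proof.
rewrite /middle_coef addnS addSn.
have -> : (1 + 'X) ^+ (2 * m) * (1 - 'X) ^+ (2 * k.+1) =
    (1 + 'X) ^+ (2 * m.+1) * (1 - 'X) ^+ (2 * k)
    - 4%:P * ((1 + 'X) ^+ (2 * m) * (1 - 'X) ^+ (2 * k) * 'X) :> {poly int}.
  rewrite !mulnS !exprD (_ : 4%:P = 4) ?polyC_natr //; first by ring.
by rewrite coefB coefCM coefMX.
Qed.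

(** The super Catalan formula with denominators cleared, so that it can be stated in [int]. The
    induction on [k] keeps [m] general because [middle_coefS] trades a step in [k] for one in
    [m]. *)
Lemma middle_coef_fact (m k : nat) :
  middle_coef m k * (k`!%:Z * m`!%:Z * (m + k)`!%:Z)
  = (-1) ^+ k * ((2 * k)`!%:Z * (2 * m)`!%:Z).
Proof.
elim: k m => [|k IHk] m.
  have := @bin_fact (2 * m) m; rewrite leq_pmull // => /(_ isT).
  rewrite middle_coef0 muln0 addn0 !fact0 expr0 => <-.
  have -> : (2 * m - m = m)%N by lia.
  by rewrite !PoszM; ring.
have m1_neq0 : m.+1%:Z != 0 by [].
(* The extra factor [m + 1] completes [m!] to [(m + 1)!], as the induction hypothesis at [m.+1]
   requires. *)
apply: (mulIf m1_neq0); rewrite middle_coefS.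
have e2 (p : nat) : (2 * p.+1)`!%:Z =
    (2 * p%:Z + 2) * (2 * p%:Z + 1) * (2 * p)`!%:Z.
  by rewrite mulnS /= !factS !PoszM mulrA; congr (_ * _ * _); lia.
have := IHk m.+1; have := IHk m; rewrite addnS addSn !e2 !factS !PoszM.
rewrite -!natz -!natr1 !natz PoszD exprS => IH0 IH1.
transitivity ((k%:Z + 1) * (middle_coef m.+1 k *
  (k`!%:Z * ((m%:Z + 1) * m`!%:Z) * ((m%:Z + k%:Z + 1) * (m + k)`!%:Z)))
  - 4 * (k%:Z + 1) * (m%:Z + 1) * (m%:Z + k%:Z + 1) *
  (middle_coef m k * (k`!%:Z * m`!%:Z * (m + k)`!%:Z))); first by ring.
by rewrite IH0 IH1; ring.
Qed.

(** The factor [(m + k)!] cancels between the binomial and the super Catalan number, leaving two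
    central binomials. With [m + k = n], this binomial is the one from expanding the [n]-th
    power. *)
Lemma bin_middle_coef (m k : nat) :
  'C(m + k, k)%:Z * middle_coef m k
  = (-1) ^+ k * ('C(2 * k, k)%:Z * 'C(2 * m, m)%:Z).
Proof.
have fact_neq0 (p : nat) : p`!%:Z != 0 by rewrite eqz_nat -lt0n fact_gt0.
have nz : k`!%:Z ^+ 2 * m`!%:Z ^+ 2 != 0 by rewrite mulf_neq0 ?expf_neq0.
have central (p : nat) : (2 * p)`!%:Z = 'C(2 * p, p)%:Z * p`!%:Z ^+ 2.
  rewrite -(@bin_fact (2 * p) p) ?leq_pmull //.
  by have -> : (2 * p - p = p)%N by lia.
apply: (mulIf nz); have := middle_coef_fact m k; rewrite !central.
have <- := @bin_fact (m + k) k (leq_addl m k); rewrite addnK !PoszM => e.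
transitivity (middle_coef m k *
  (k`!%:Z * m`!%:Z * ('C(m + k, k)%:Z * (k`!%:Z * m`!%:Z)))); first by ring.
by rewrite e; ring.
Qed.

(** The ring is arbitrary so that [z] can later be the indeterminate of [{poly int}]. *)
Lemma central_bin_conv (R : comNzRingType) (z : R) (n : nat) :
  \sum_(k < n.+1) ('C(2 * k, k) * 'C(2 * (n - k), n - k))%:R * z ^+ (2 * k)
  = \sum_(k < n.+1)
      ('C(n, k) ^ 2)%:R * ((1 - z) ^+ (2 * k) * (1 + z) ^+ (2 * (n - k))).
Proof.
pose a := 1 - z; pose b := 1 + z.
have coefn_eq : ((b%:P + a%:P * 'X) ^+ n * (a%:P + b%:P * 'X) ^+ n)`_n
    = (((1 + 'X) ^+ 2 + (- (z ^+ 2))%:P * (1 - 'X) ^+ 2) ^+ n)`_n.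
  rewrite -exprMn (_ : (b%:P + a%:P * 'X) * _ =
      (1 + 'X) ^+ 2 + (- (z ^+ 2))%:P * (1 - 'X) ^+ 2) //.
  by rewrite /a /b !(polyCD, polyCN, polyC_exp) polyC1; ring.
(* The same coefficient is expanded as a Cauchy product on one side and by the binomial theorem on
   the other. *)
rewrite coefM [in RHS]exprDn coef_sum in coefn_eq; symmetry.
transitivity (\sum_(k < n.+1) ((b%:P + a%:P * 'X) ^+ n)`_k *
    ((a%:P + b%:P * 'X) ^+ n)`_(n - k)).
  apply: eq_bigr => -[k /= le_kn] _; rewrite ltnS in le_kn.
  rewrite !coef_linear_exp subKn // bin_sub // natrX !mul2n -!addnn !exprD.
  by rewrite /a /b; ring.
rewrite coefn_eq; apply: eq_bigr => -[k /= le_kn] _; rewrite ltnS in le_kn.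
have := bin_middle_coef (n - k) k; rewrite /middle_coef subnK //.
(* The integer identity is carried to [R] by the canonical morphism, applied coefficientwise to the
   polynomial. *)
move=> /(congr1 (fun x : int => x%:~R : R)); rewrite !rmorphM rmorphXn.
rewrite rmorphN1 /= -coef_map /= rmorphM !rmorphXn rmorphD rmorphB rmorph1 /=.
rewrite map_polyX -!pmulrn => e.
rewrite -exprM exprMn -exprM -polyC_exp mulrCA coefMn coefCM.
rewrite exprNn -exprM -mulr_natr.
transitivity (((-1) ^+ k * z ^+ (2 * k)) * ('C(n, k)%:R *
   ((1 + 'X) ^+ (2 * (n - k)) * (1 - 'X) ^+ (2 * k))`_n)); first by ring.
(* The sign from [(- z^2)^k] cancels the sign of the middle coefficient. *)
rewrite e mulrCA !mulrA -exprMn mulrNN mulr1 expr1n; ring.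
Qed.

Section Umbral.
Variable X : int -> int.
Hypothesis X_rec : forall j, X j = X (j - 1) + X (j - 2).

(** The offset [r] stays an argument so that multiplying [p] by a polynomial becomes a shift of
    [r]. *)
Definition umbral (p : {poly int}) (r : int) : int :=
  \sum_(i < size p) p`_i * X (i%:Z + r).

Lemma umbral_wide (N : nat) (p : {poly int}) (r : int) :
  (size p <= N)%N -> umbral p r = \sum_(i < N) p`_i * X (i%:Z + r).
Proof.
move=> le_pN; rewrite /umbral (big_ord_widen N (fun i => p`_i * X (i%:Z + r))) //.
rewrite big_mkcond; apply: eq_bigr => i _; case: ltnP => // le_pi.
by rewrite nth_default // mul0r.
Qed.

Lemma umbralD (p q : {poly int}) (r : int) :
  umbral (p + q) r = umbral p r + umbral q r.
Proof.
pose N := maxn (size p) (size q).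
rewrite !(@umbral_wide N) ?leq_maxl ?leq_maxr ?size_polyD //.
by rewrite -big_split; apply: eq_bigr => i _; rewrite coefD mulrDl.
Qed.

Lemma umbralZ (c : int) (p : {poly int}) (r : int) :
  umbral (c *: p) r = c * umbral p r.
Proof.
rewrite !(@umbral_wide (size p)) ?size_scale_leq //.
by rewrite mulr_sumr; apply: eq_bigr => i _; rewrite coefZ mulrA.
Qed.

Lemma umbral_sum (n : nat) (c : 'I_n -> int) (p : 'I_n -> {poly int}) (r : int) :
  umbral (\sum_(i < n) c i *: p i) r = \sum_(i < n) c i * umbral (p i) r.
Proof.
apply: (big_ind2 (fun q s => umbral q r = s)) => [|q s q' s' <- <-|i _].
- by rewrite /umbral size_poly0 big_ord0.
- exact: umbralD.
- exact: umbralZ.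
Qed.

Lemma umbralXn (i : nat) (r : int) : umbral 'X^i r = X (i%:Z + r).
Proof.
rewrite /umbral size_polyXn big_ord_recr /= coefXn eqxx mul1r big1 ?add0r //.
by move=> j _; rewrite coefXn ltn_eqF ?mul0r.
Qed.

Lemma umbralMX (p : {poly int}) (r : int) : umbral (p * 'X) r = umbral p (r + 1).
Proof.
rewrite (@umbral_wide (size p).+1) ?(leq_trans (size_polyMleq _ _)) //; last first.
  by rewrite size_polyX addn2.
rewrite big_ord_recl coefMX mul0r add0r; apply: eq_bigr => i _.
by rewrite coefMX /=; congr (_ * X _); rewrite /bump /=; lia.
Qed.

Lemma umbral_rec (p : {poly int}) (r : int) :
  umbral p r = umbral p (r - 1) + umbral p (r - 2).
Proof.
rewrite -big_split; apply: eq_bigr => i _.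
by rewrite X_rec mulrDr !addrA.
Qed.

Lemma umbralM1DX (p : {poly int}) (r : int) :
  umbral (p * (1 + 'X)) r = umbral p (r + 2).
Proof.
rewrite mulrDr mulr1 umbralD umbralMX (umbral_rec p (r + 2)) addrC.
by congr (umbral p _ + umbral p _); lia.
Qed.

Lemma umbralM1BX (p : {poly int}) (r : int) :
  umbral (p * (1 - 'X)) r = - umbral p (r - 1).
Proof.
rewrite mulrDr mulr1 mulrN -scaleN1r umbralD umbralZ umbralMX.
rewrite (umbral_rec p (r + 1)).
have -> : r + 1 - 1 = r by lia.
have -> : r + 1 - 2 = r - 1 by lia.
by ring.
Qed.

(** Each [(1 + 'X)^2] shifts by 4 and each [(1 - 'X)^2] by -2; the even exponents remove the
    signs. *)
Lemma umbral_1BX_1DX (k m : nat) (r : int) :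
  umbral ((1 - 'X) ^+ (2 * k) * (1 + 'X) ^+ (2 * m)) r
  = X (4 * m%:Z - 2 * k%:Z + r).
Proof.
elim: m r => [|m IHm] r.
  rewrite muln0 expr0 mulr1; elim: k r => [|k IHk] r.
    by rewrite muln0 expr0 -(expr0 'X) umbralXn; congr X; lia.
  rewrite mulnS addnC exprD expr2 mulrA !umbralM1BX opprK IHk.
  by congr X; lia.
rewrite mulnS addnC exprD mulrA expr2 mulrA !umbralM1DX IHm.
by congr X; lia.
Qed.

Lemma central_bin_conv_umbral (r : int) (n : nat) :
  \sum_(0 <= k < n.+1)
      'C(2 * k, k)%:Z * 'C(2 * (n - k), n - k)%:Z * X (2 * k%:Z + r)
  = \sum_(0 <= k < n.+1) 'C(n, k)%:Z ^+ 2 * X (6 * k%:Z - 2 * n%:Z + r).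
Proof.
have scale_nat (c : nat) (p : {poly int}) : c%:R * p = c%:Z *: p.
  by rewrite -natz scaler_nat mulr_natl.
have := congr1 (umbral^~ r) (central_bin_conv {poly int} 'X n).
under eq_bigr do rewrite scale_nat.
under [X in _ = umbral X _]eq_bigr do rewrite scale_nat.
(* Reversal matches the indices: [4(n - k) - 2k = 6(n - k) - 2n]. *)
rewrite !umbral_sum => e; rewrite [RHS]big_nat_rev !big_mkord /=.
transitivity (\sum_(k < n.+1) ('C(2 * k, k) * 'C(2 * (n - k), n - k))%:Z *
    umbral 'X^(2 * k) r).
  by apply: eq_bigr => k _; rewrite umbralXn PoszM.
rewrite e; apply: eq_bigr => -[k /= le_kn] _; rewrite ltnS in le_kn.
rewrite umbral_1BX_1DX add0n subSS bin_sub // -!natz natrX !natz.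
by congr (_ * X _); lia.
Qed.

End Umbral.

Theorem theorem20 (r : int) (n : nat) :
  (\sum_(0 <= k < n.+1)
      'C(2 * k, k)%:Z * 'C(2 * (n - k), n - k)%:Z * fibz (2 * k%:Z + r)
   = \sum_(0 <= k < n.+1)
      'C(n, k)%:Z ^+ 2 * fibz (6 * k%:Z - 2 * n%:Z + r))
  /\
  (\sum_(0 <= k < n.+1)
      'C(2 * k, k)%:Z * 'C(2 * (n - k), n - k)%:Z * lucz (2 * k%:Z + r)
   = \sum_(0 <= k < n.+1)
      'C(n, k)%:Z ^+ 2 * lucz (6 * k%:Z - 2 * n%:Z + r)).
Proof. by split; apply: central_bin_conv_umbral; apply: two_sided_rec. Qed.
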